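(* Let $k\in\mathcal{K}$ be a valid measurable kernel on $\mathbb{R}^n$ and let $\bar k\in\mathcal{K}$ be the associated kernel centered at $\mathbf{0}$, $\bar k(\mathbf{r},\mathbf{r}'):=k(\mathbf{r},\mathbf{r}')+k(\mathbf{0},\mathbf{0})-k(\mathbf{r},\mathbf{0})-k(\mathbf{0},\mathbf{r}')$. Assume that $\mathbb{E}[\sqrt{k(\mathbf{G},\mathbf{G})}]<\infty$ for all $\mathbf{G}\sim F$ and all $F\in\mathcal{F}$. (i) If $k$ is a characteristic kernel, then $\bar k\in\mathcal{K}_E$. (ii) If $k$ is a radial-based characteristic kernel, i.e. $k(\mathbf{r},\mathbf{r}')=\int e^{-i(\mathbf{r}-\mathbf{r}')^{T}\mathbf{w}}\,d\Lambda(\mathbf{w})$ with $\Lambda$ a positive and bounded Borel measure on $\mathbb{R}^n$ with support $\mathrm{Supp}(\Lambda)=\mathbb{R}^n$, then $k\in\mathcal{K}_E$.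
   Context: Setting. $f:\mathbb{R}^d\to\mathbb{R}^n$ is a function and $\mathbf{X}=(X_1,\ldots,X_d)$ a random vector. For $\emptyset\ne u\subseteq\{1,\ldots,d\}$, $\mathbf{X}_u:=(X_j)_{j\in u}$, $\mathbf{X}_{\sim u}:=(X_j)_{j\notin u}$. The dependency model is $\mathbf{X}_{\sim u}\stackrel{d}{=}r_u(\mathbf{X}_u,\mathbf{Z})$, with $r_u$ a function, $\mathbf{Z}$ a vector of $d-|u|$ independent variables, and $\mathbf{X}_u$ independent of $\mathbf{Z}$; $g(\mathbf{X}_u,\mathbf{Z}):=f(\mathbf{X}_u,r_u(\mathbf{X}_u,\mathbf{Z}))\stackrel{d}{=}f(\mathbf{X})$ ($r_u,\mathbf{Z},g$ depend on $u$). The first-order and total ANOVA functionals (AFs) of $\mathbf{X}_u$ are $g^{fo}_u(\mathbf{X}_u):=\mathbb{E}_{\mathbf{Z}}[g(\mathbf{X}_u,\mathbf{Z})]-\mathbb{E}[g(\mathbf{X}_u,\mathbf{Z})]$ and $g^{tot}_u(\mathbf{X}_u,\mathbf{Z}):=g(\mathbf{X}_u,\mathbf{Z})-\mathbb{E}_{\mathbf{X}_u}[g(\mathbf{X}_u,\mathbf{Z})]$ (expectations assumed to exist). $\mathcal{F}$ is the set of Borel probability distributions $F$ on $\mathbb{R}^n$ such that $g^{tot}_u(\mathbf{X}_u,\mathbf{Z})\sim F$ or $g^{fo}_u(\mathbf{X}_u)\sim F$ for some $u\subseteq\{1,\ldots,d\}$. Kernels. $\mathcal{K}$ is the set of valid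 measurable kernels $k:\mathbb{R}^n\times\mathbb{R}^n\to\mathbb{R}$, i.e. $k(r,r')=\langle\phi(r),\phi(r')\rangle$ for some map $\phi$ into a Hilbert space. $k$ is centered at $\mathbf{0}$ if $k(\cdot,\mathbf{0})=0$. The mean element of $\mathbf{G}\sim F$ is $\mathbb{E}_F[k(\cdot,\mathbf{G})]$ (in the RKHS of $k$); a measurable kernel is characteristic if the mean elements of two distributions coincide if and only if the distributions coincide. $H$ denotes the CDF of the Dirac measure $\delta_{\mathbf{0}}$. $\mathcal{K}_E$ is the set of $k\in\mathcal{K}$ satisfying at least one of: (a) $k$ is centered at $\mathbf{0}$ and, for all $F\in\mathcal{F}$, $\mathbb{E}_{\mathbf{G}\sim F,\mathbf{G}'\sim F}[k(\mathbf{G},\mathbf{G}')]=0\Rightarrow F=H$ ($\mathbf{G},\mathbf{G}'$ independent); (b) for all signed measures $\nu=F\otimes F-H\otimes H$ with $F\in\mathcal{F}$, $\int k\,d\nu=0\Rightarrow\nu=0$. *)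

(* Defs.v *)
From HB Require Import structures.
From mathcomp Require Import all_boot all_order all_algebra.
From mathcomp Require Import all_classical all_reals all_analysis.
From mathcomp Require Import complex.

Set Implicit Arguments.
Unset Strict Implicit.
Unset Printing Implicit Defensive.

Import Order.TTheory GRing.Theory Num.Theory.
Import numFieldNormedType.Exports.

Local Open Scope classical_set_scope.
Local Open Scope ring_scope.

(* R^n carries its Borel sigma-algebra, i.e. the one generated by the open
   sets; in particular [probability 'rV[R]_n R] is the type of Borel
   probability distributions on R^n. *)
HB.instance Definition _ (R : realType) (n : nat) :=
  Measurable.copy 'rV[R]_n (g_sigma_algebraType (@open 'rV[R]_n)).

(* Measures are functions on all sets, so equality of distributions has to be
   restricted to measurable sets. *)
Definition eq_measure (d : measure_display) (T : measurableType d)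
    (R : realType) (mu nu : set T -> \bar R) : Prop :=
  forall A, measurable A -> mu A = nu A.

Section Subvectors.
Context (R : realType) (d : nat).
Implicit Types u : {set 'I_d}.

(* x_u := (x_j)_{j in u}, the coordinates being listed in increasing order. *)
Definition subvec u (x : 'rV[R]_d) : 'rV[R]_#|u| :=
  \row_i x ord0 (enum_val i).

(* The vector of R^d whose u-coordinates are x and whose other coordinates
   are y: for each j exactly one of the two sums has a (single) term. *)
Definition merge u (x : 'rV[R]_#|u|) (y : 'rV[R]_#|~: u|) : 'rV[R]_d :=
  \row_j (\sum_(i | enum_val i == j) x ord0 i
          + \sum_(i | enum_val i == j) y ord0 i).

Lemma merge_subvec u (x : 'rV[R]_d) :
  merge (subvec u x) (subvec (~: u) x) = x.
Proof.
have H (A : {set 'I_d}) j :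
    \sum_(i | enum_val i == j) subvec A x ord0 i
    = if j \in A then x ord0 j else 0.
  case: ifPn => jA.
    rewrite (big_pred1 (enum_rank_in jA j)).
      by rewrite mxE enum_rankK_in.
    move=> i /=; apply/eqP/eqP => [ij|->]; last by rewrite enum_rankK_in.
    by apply: enum_val_inj; rewrite enum_rankK_in.
  rewrite big_pred0// => i; apply/negbTE; apply: contraNneq jA => <-.
  exact: enum_valP.
apply/rowP => j; rewrite mxE !H inE.
by case: (j \in u); rewrite ?addr0 ?add0r.
Qed.

End Subvectors.

Section Independence.
Context (dO : measure_display) (Omega : measurableType dO) (R : realType).
Variable P : probability Omega R.

Definition independent_rv (d1 d2 : measure_display) (T1 : measurableType d1)
    (T2 : measurableType d2) (X : Omega -> T1) (Y : Omega -> T2) : Prop :=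
  forall A B, measurable A -> measurable B ->
    P (X @^-1` A `&` Y @^-1` B) = (P (X @^-1` A) * P (Y @^-1` B))%E.

Definition independent_coords (m : nat) (Z : Omega -> 'rV[R]_m) : Prop :=
  forall (J : {set 'I_m}) (A : 'I_m -> set R),
    (forall j, measurable (A j)) ->
    P (\bigcap_(j in [set` J]) [set w | A j (Z w ord0 j)])
    = (\prod_(j in J) P [set w | A j (Z w ord0 j)])%E.

End Independence.

Section Anova.
Context (dO : measure_display) (Omega : measurableType dO) (R : realType).
Variable P : probability Omega R.
Context (d n : nat).
Variable f : {mfun 'rV[R]_d >-> 'rV[R]_n}.
Variable X : {RV P >-> 'rV[R]_d}.

Section OneSubset.
Variable u : {set 'I_d}.
Variable r :
  {mfun ('rV[R]_#|u| * 'rV[R]_(d - #|u|))%type >-> 'rV[R]_#|~: u|}.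
Variable Z : {RV P >-> 'rV[R]_(d - #|u|)}.

Definition Xu (w : Omega) : 'rV[R]_#|u| := subvec u (X w).

Definition outg (x : 'rV[R]_#|u|) (z : 'rV[R]_(d - #|u|)) : 'rV[R]_n :=
  f (merge x (r (x, z))).

Record dependency_model : Prop := DependencyModel {
  dm_law : eq_measure (pushforward P (fun w => subvec (~: u) (X w)))
                      (pushforward P (fun w => r (Xu w, Z w)));
  dm_output : eq_measure (pushforward P (fun w => outg (Xu w) (Z w)))
                         (pushforward P (fun w => f (X w)));
  dm_indepZ : independent_coords P Z;
  dm_indep : independent_rv P Xu Z }.

(* E[g(X_u, Z)] exists.  By Fubini's theorem E_Z[g(x, Z)] and E_{X_u}[g(X_u, z)]
   then exist for almost all x and z; elsewhere the total operators used below
   return an arbitrary value, which does not affect any law. *)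
Definition expectation_exists : Prop :=
  forall i : 'I_n,
    P.-integrable setT (fun w => (outg (Xu w) (Z w) ord0 i)%:E).

Definition AF_first_order (x : 'rV[R]_#|u|) : 'rV[R]_n :=
  \row_i (fine ('E_P[fun w => outg x (Z w) ord0 i])
          - fine ('E_P[fun w => outg (Xu w) (Z w) ord0 i])).

Definition AF_total (x : 'rV[R]_#|u|) (z : 'rV[R]_(d - #|u|)) : 'rV[R]_n :=
  \row_i (outg x z ord0 i - fine ('E_P[fun w => outg (Xu w) z ord0 i])).

End OneSubset.

Definition AF_laws
    (r : forall u : {set 'I_d},
      {mfun ('rV[R]_#|u| * 'rV[R]_(d - #|u|))%type >-> 'rV[R]_#|~: u|})
    (Z : forall u : {set 'I_d}, {RV P >-> 'rV[R]_(d - #|u|)}) :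
    set (probability 'rV[R]_n R) :=
  [set F : probability 'rV[R]_n R | exists2 u : {set 'I_d}, u != finset.set0 &
     eq_measure (pushforward P (fun w => AF_total (r u) (Xu u w) (Z u w)))
                F
     \/ eq_measure (pushforward P (fun w => AF_first_order (r u) (Z u) (Xu u w)))
                   F].

End Anova.

Section ChargeIntegral.
Context (d : measure_display) (T : measurableType d) (R : realType).
Variable nu : {charge set T -> \bar R}.

(* int h dnu = int h dnu^+ - int h dnu^-, with (nu^+, nu^-) the Jordan
   decomposition of nu; it does not depend on the choice of the Hahn
   decomposition, since the latter is unique up to null sets. *)
Definition hahn_pos : set T := projT1 (cid (Hahn_decomposition nu)).
Definition hahn_neg : set T :=
  projT1 (cid (projT2 (cid (Hahn_decomposition nu)))).
Definition hahn_posneg : hahn_decomposition nu hahn_pos hahn_neg :=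
  projT2 (cid (projT2 (cid (Hahn_decomposition nu)))).

Definition charge_integral (h : T -> \bar R) : \bar R :=
  (\int[jordan_pos hahn_posneg]_x h x - \int[jordan_neg hahn_posneg]_x h x)%E.

End ChargeIntegral.

Section Kernels.
Context (R : realType) (n : nat).
Implicit Types k : 'rV[R]_n -> 'rV[R]_n -> R.

Definition hilbert_product (V : completeNormedModType R) (ip : V -> V -> R) :
    Prop :=
  [/\ forall x y, ip x y = ip y x,
      forall a x y z, ip (a *: x + y) z = a * ip x z + ip y z
    & forall x, ip x x = `|x| ^+ 2].

Definition valid_kernel k : Prop :=
  measurable_fun setT (fun z : 'rV[R]_n * 'rV[R]_n => k z.1 z.2) /\
  exists (V : completeNormedModType R) (ip : V -> V -> R)
         (phi : 'rV[R]_n -> V),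
    hilbert_product ip /\ forall x y, k x y = ip (phi x) (phi y).

Definition centered_at0 k : Prop := forall x, k x 0 = 0.

Definition center_at0 k : 'rV[R]_n -> 'rV[R]_n -> R :=
  fun x y => k x y + k 0 0 - k x 0 - k 0 y.

Definition sqrt_moment k (F : probability 'rV[R]_n R) : Prop :=
  (\int[F]_x (Num.sqrt (k x x))%:E < +oo)%E.

(* The mean element E_F[k(., G)] is an element of the RKHS of k, which is a
   space of functions on R^n: it is the function x |-> E_F[k(x, G)]. *)
Definition mean_element k (F : probability 'rV[R]_n R) : 'rV[R]_n -> R :=
  fun x => (\int[F]_y k x y)%R.

(* The comparison ranges over the distributions that have a mean element, i.e.
   those for which y |-> k(., y) is Bochner integrable in the RKHS. *)
Definition characteristic_kernel k : Prop :=
  forall F G : probability 'rV[R]_n R,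
    sqrt_moment k F -> sqrt_moment k G ->
    (mean_element k F = mean_element k G <-> eq_measure F G).

Definition dirac0 : probability 'rV[R]_n R := \d_(0 : 'rV[R]_n).

(* The joint law of independent G, G' ~ F. *)
Definition iid2 (F : probability 'rV[R]_n R) :
    probability ('rV[R]_n * 'rV[R]_n)%type R := (F \x F)%E.

(* F (x) F - H (x) H *)
Definition nuF (F : probability 'rV[R]_n R) :
    {charge set ('rV[R]_n * 'rV[R]_n)%type -> \bar R} :=
  cadd (charge_of_finite_measure (iid2 F))
       (copp (charge_of_finite_measure (iid2 dirac0))).

(* An extended-real integral is 0 only if the integrand is integrable, as
   +oo - oo = -oo; so no integrability clause is needed in (a) and (b). *)
Definition KE_a (FF : set (probability 'rV[R]_n R)) k : Prop :=
  centered_at0 k /\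
  forall F, FF F ->
    (\int[iid2 F]_z (k z.1 z.2)%:E = 0)%E -> eq_measure F dirac0.

Definition KE_b (FF : set (probability 'rV[R]_n R)) k : Prop :=
  forall F, FF F ->
    charge_integral (nuF F) (fun z => (k z.1 z.2)%:E) = 0%E ->
    eq_measure (nuF F) (fun=> 0%E).

Definition KE (FF : set (probability 'rV[R]_n R)) k : Prop :=
  valid_kernel k /\ (KE_a FF k \/ KE_b FF k).

Definition measure_support (La : set 'rV[R]_n -> \bar R) : set 'rV[R]_n :=
  [set w | forall U, open U -> U w -> (0 < La U)%E].

(* e^{it} *)
Definition expi (t : R) : R[i] := (cos t +i* sin t)%C.

Definition complex_integral (d : measure_display) (T : measurableType d)
    (mu : {measure set T -> \bar R}) (h : T -> R[i]) : R[i] :=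
  ((\int[mu]_x complex.Re (h x))%R +i* (\int[mu]_x complex.Im (h x))%R)%C.

Definition radial_characteristic_kernel k : Prop :=
  exists La : {finite_measure set 'rV[R]_n -> \bar R},
    measure_support La = setT /\
    forall x y, (k x y)%:C%C =
      complex_integral La (fun w => expi (- ((x - y) *m w^T) ord0 ord0)).

End Kernels.

(* Main.v *)
(* (i) If [k x y = <phi x, phi y>] and [m] is the mean of [phi] under [F], the
   energy of the centered kernel is [|m - phi 0|^2].  If it vanishes, [F] and the
   Dirac mass at 0 have the same mean element, and they agree since [k] is
   characteristic.  The vector [m] itself is never built: [v |-> <v, m>] is the
   bounded functional [v |-> E <v, phi>], which suffices.

   (ii) Here [int k d(F x F) = k 0 0], while [k <= k 0 0], with equality only on
   the diagonal because the spectral measure has full support.  Hence [F x F] is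
   carried by the diagonal and [F] is a point mass at some [c].  The ANOVA
   functionals have mean zero by Fubini, so [c = 0]. *)

Require Import Defs.
From HB Require Import structures.
From mathcomp Require Import all_boot all_order all_algebra.
From mathcomp Require Import all_classical all_reals all_analysis.
From mathcomp Require Import complex measurable_realfun.
From mathcomp Require Import ring lra.

Set Implicit Arguments.
Unset Strict Implicit.
Unset Printing Implicit Defensive.

Import Order.TTheory GRing.Theory Num.Theory.
Import numFieldNormedType.Exports.

Local Open Scope classical_set_scope.
Local Open Scope ring_scope.

(** * Inner products and the Cauchy-Schwarz inequality *)

Section HilbertProduct.
Context (R : realType) (V : completeNormedModType R) (ip : V -> V -> R).
Hypothesis ipV : hilbert_product ip.

Let ipC x y : ip x y = ip y x. Proof. by have [+ _ _] := ipV; exact. Qed.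
Let ipE x : ip x x = `|x| ^+ 2. Proof. by have [_ _] := ipV; exact. Qed.

Lemma ip_linearl a x y z : ip (a *: x + y) z = a * ip x z + ip y z.
Proof. by have [_ + _] := ipV; exact. Qed.

Lemma ip0l z : ip 0 z = 0.
Proof.
have := ip_linearl 1 0 0 z; rewrite scaler0 addr0 mul1r => /eqP.
by rewrite -subr_eq subrr eq_sym => /eqP.
Qed.

Lemma ipBl x y z : ip (x - y) z = ip x z - ip y z.
Proof. by rewrite -scaleN1r addrC ip_linearl mulN1r addrC. Qed.

Lemma ip_sqrD t x y :
  `|x + t *: y| ^+ 2 = `|x| ^+ 2 + 2 * t * ip x y + t ^+ 2 * `|y| ^+ 2.
Proof.
rewrite -!ipE [x + _]addrC ip_linearl [ip y _]ipC [ip x (_ + _)]ipC.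
by rewrite !ip_linearl [ip y x]ipC; ring.
Qed.

(** The quadratic in [t] has leading coefficient [c ^+ 2] because [c] is a norm in both uses:
    Cauchy-Schwarz and the near-minimiser of a quadratic functional. *)
Lemma discriminant_le (a b c : R) : 0 <= a -> 0 <= c ->
  (forall t, 0 <= a + 2 * t * b + t ^+ 2 * c ^+ 2) ->
  b ^+ 2 <= a * c ^+ 2.
Proof.
move=> a0 c0 h; have [c_eq0|c_neq0] := eqVneq c 0.
  rewrite {}c_eq0 in h *.
  have [->|b0] := eqVneq b 0; first by rewrite expr0n mulr0.
  (* With [c = 0] the polynomial is affine of slope [2 * b]; at this [t] it equals -1. *)
  have := h (- (a + 1) / (2 * b)).
  have -> : a + 2 * (- (a + 1) / (2 * b)) * b +
     (- (a + 1) / (2 * b)) ^+ 2 * 0 ^+ 2 = -1 by field.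
  by rewrite ler0N1.
have c2 : 0 < c ^+ 2 by rewrite exprn_gt0// lt_def c_neq0.
(* The minimiser of the quadratic. *)
have := h (- b / c ^+ 2).
have -> : a + 2 * (- b / c ^+ 2) * b + (- b / c ^+ 2) ^+ 2 * c ^+ 2 =
  a - b ^+ 2 / c ^+ 2 by field.
by rewrite subr_ge0 ler_pdivrMr.
Qed.

Lemma ip_cauchy_schwarz x y : `|ip x y| <= `|x| * `|y|.
Proof.
rewrite -(@ler_pXn2r _ 2)// ?nnegrE ?mulr_ge0//.
rewrite real_normK ?num_real// exprMn.
by apply: discriminant_le => // t; rewrite -ip_sqrD exprn_ge0.
Qed.

End HilbertProduct.

(** * Zero energy forces a zero mean *)

Section MeanElementVanishes.
Context (R : realType) (V : completeNormedModType R) (ip : V -> V -> R).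
Hypothesis ipV : hilbert_product ip.
Context (d : measure_display) (T : measurableType d) (mu : probability T R).
Variable psi : T -> V.
Hypothesis mpsi : measurable_fun setT (fun z : T * T => ip (psi z.1) (psi z.2)).
Hypothesis ipsi : mu.-integrable setT (fun x => `|psi x|%:E).

(** Measurability is assumed of the kernel, not of [psi], so [L] is studied only on these vectors.
    They form a linear subspace containing every [psi x]. There [L v] plays the role of [<v, m>],
    with [m] the mean of [psi], and [C] bounds its norm. *)
Let H0 := [set v | measurable_fun setT (fun y => ip v (psi y))].
Let L v := (\int[mu]_y ip v (psi y))%R.
Let C := (\int[mu]_y `|psi y|)%R.

Let C0 : 0 <= C. Proof. exact: Rintegral_ge0. Qed.

Let H0_psi x : H0 (psi x).
Proof. exact: (measurable_fun_pair2 x mpsi). Qed.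

Let H0_linear a v w : H0 v -> H0 w -> H0 (v + a *: w).
Proof.
rewrite /H0/= => mv mw; apply: eq_measurable_fun (_ : measurable_fun _
  (fun y => a * ip w (psi y) + ip v (psi y))).
  by move=> y _; rewrite [in RHS]addrC (ip_linearl ipV).
by apply: measurable_funD => //; exact: measurable_funM.
Qed.

Let H0_integrable v : H0 v ->
  mu.-integrable setT (fun y => (ip v (psi y))%:E).
Proof.
move=> mv; apply: le_integrable (integrableZl measurableT `|v| ipsi) => //.
  exact/measurable_EFinP.
move=> y _; rewrite -EFinM !abse_EFin lee_fin [leRHS]ger0_norm ?mulr_ge0//.
exact: ip_cauchy_schwarz.
Qed.

Let L_linear a v w : H0 v -> H0 w -> L (v + a *: w) = L v + a * L w.
Proof.
move=> mv mw; rewrite /L -RintegralZl//; last exact: H0_integrable.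
rewrite -RintegralD//; first by apply: eq_Rintegral => y _;
  rewrite [v + _]addrC (ip_linearl ipV) addrC.
  exact: H0_integrable.
exact: (integrableZl measurableT a (H0_integrable mw)).
Qed.

Let L_bound v : H0 v -> `|L v| <= `|v| * C.
Proof.
move=> mv; rewrite /L (le_trans (le_normr_Rintegral measurableT _))//.
  exact: H0_integrable.
rewrite /C -RintegralZl//; apply: le_Rintegral => //.
- exact/integrable_norm/H0_integrable.
- exact: (integrableZl measurableT _ ipsi).
- by move=> y _; exact: ip_cauchy_schwarz.
Qed.

(* Riesz representation up to [e], in a form which needs no limit: a
   near-minimiser [v] of [|v|^2 - 2 L v] almost represents [L]. *)
Let approx_riesz e : 0 < e ->
  exists2 v, H0 v & forall w, H0 w -> `|ip v w - L w| <= e * `|w|.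
Proof.
move=> e0; pose J v := `|v| ^+ 2 - 2 * L v.
have infJ : has_inf [set J v | v in H0].
  split.
    exists (J 0); exists 0 => //; rewrite /H0/=.
    by rewrite (_ : (fun=> _) = cst 0)//; apply/funext => y; rewrite (ip0l ipV).
  (* [|v|^2 - 2 L v >= |v|^2 - 2 C |v| = (|v| - C)^2 - C^2]. *)
  exists (- C ^+ 2) => _ [v mv <-].
  have := L_bound mv; rewrite ler_norml => /andP[_ Lv].
  have := sqr_ge0 (`|v| - C); rewrite /J; nra.
have [_ [v mv <-] Jv] := inf_adherent (exprn_gt0 2 e0) infJ.
exists v => // w mw.
rewrite -(@ler_pXn2r _ 2)// ?nnegrE ?mulr_ge0//; last exact: ltW.
rewrite real_normK ?num_real// exprMn.
(* The quadratic is [J (v + t *: w) - J v + e ^+ 2], nonnegative since [J v] is within [e ^+ 2] of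
   the infimum. *)
apply: discriminant_le; [exact: sqr_ge0|by []|move=> t].
have : inf [set J v | v in H0] <= J (v + t *: w).
  by apply: (ge_inf infJ.2); exists (v + t *: w) => //; exact: H0_linear.
move: (inf _) Jv => m; rewrite /J (ip_sqrD ipV) L_linear//; lra.
Qed.

Hypothesis energy0 : (\int[mu \x mu]_z (ip (psi z.1) (psi z.2))%:E = 0)%E.

(** By Tonelli and Cauchy-Schwarz, the iterated integral of the absolute value is at most
    [C ^+ 2]. *)
Let int2 : (mu \x mu)%E.-integrable setT
  (fun z => (ip (psi z.1) (psi z.2))%:E).
Proof.
apply/integrable12ltyP; first exact/measurable_EFinP.
have mnorm : measurable_fun setT (fun x => `|psi x|%:E).
  exact: measurable_int ipsi.
apply: (@le_lt_trans _ _ (\int[mu]_x (`|psi x|%:E * \int[mu]_y `|psi y|%:E)))%E.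
  apply: ge0_le_integral => //.
  - by move=> x _; exact: integral_ge0.
  - apply: (measurable_fun_fubini_tonelli_F
      (fun z => `|(ip (psi z.1) (psi z.2))%:E|)%E) => //.
    by apply/measurableT_comp => //; exact/measurable_EFinP.
  - by apply: emeasurable_funM.
  - move=> x _; rewrite -ge0_integralZl//.
    apply: ge0_le_integral => //.
    + by apply/measurableT_comp => //; apply/measurable_EFinP; exact: H0_psi.
    + by apply: emeasurable_funM.
    + by move=> y _; rewrite -EFinM abse_EFin lee_fin ip_cauchy_schwarz.
have fC : (\int[mu]_y `|psi y|%:E)%E \is a fin_num by exact: integrable_fin_num.
rewrite -(fineK fC).
under eq_integral do rewrite muleC.
rewrite ge0_integralZl//.
by rewrite -(fineK fC) -EFinM ltry.
Qed.

Let LpsiE x : (\int[mu]_y (ip (psi x) (psi y))%:E)%E = (L (psi x))%:E.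
Proof. by rewrite /L /Rintegral fineK//; exact/integrable_fin_num/H0_integrable/H0_psi. Qed.

Let iLpsi : mu.-integrable setT (fun x => (L (psi x))%:E).
Proof.
apply: eq_integrable (integrable_fubini_F int2) => //.
by move=> x _; rewrite -LpsiE.
Qed.

(** Formally this is [<m, m> = 0]: by Fubini the left side is the energy. *)
Let Lpsi0 : (\int[mu]_x L (psi x))%R = 0.
Proof.
rewrite /Rintegral; under eq_integral do rewrite -LpsiE.
by rewrite (integral12_prod_meas1 int2) energy0.
Qed.

(** An approximate representative [v] of [L] stands in for [m]. The vanishing of [|m|^2] becomes a
    small bound on [|v|], and [L w] is close to [ip v w]. *)
Lemma mean_element_vanishes w : measurable_fun setT (fun y => ip w (psi y)) ->
  (\int[mu]_y ip w (psi y))%R = 0.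
Proof.
move=> mw; rewrite -/(L w); apply/eqP; rewrite -normr_le0 leNgt.
apply/negP => Lw.
(* The estimates below end in [|L w| <= e * (C + 2) * |w|]; the added 1 makes [B] positive and turns
   this into [|L w| < e * B], against the choice of [e]. *)
pose B := (C + 2) * `|w| + 1.
have B0 : 0 < B by rewrite /B ltr_wpDl// mulr_ge0// addr_ge0.
pose e := Num.min 1 (`|L w| / B).
have e0 : 0 < e by rewrite /e lt_min ltr01 divr_gt0.
have e1 : e <= 1 by rewrite /e ge_min lexx.
have eB : e * B <= `|L w| by rewrite -ler_pdivlMr// /e ge_min lexx orbT.
(* Precision [e ^+ 2], since the bound obtained is on [|v| ^+ 2] and its square root must be of
   order [e]. *)
have [v mv vL] := approx_riesz (exprn_gt0 2 e0).
have Lv : `|L v| <= e ^+ 2 * C.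
  (* Subtracting [L (psi x)], whose integral is 0, leaves an integrand that [vL] bounds by
     [e ^+ 2 * |psi x|]. *)
  have -> : L v = (\int[mu]_x (ip v (psi x) - L (psi x)))%R.
    by rewrite RintegralB//; [rewrite Lpsi0 subr0|exact: H0_integrable].
  have iB : mu.-integrable setT (fun x => (ip v (psi x) - L (psi x))%:E).
    exact: (integrableB measurableT (H0_integrable mv) iLpsi).
  rewrite (le_trans (le_normr_Rintegral measurableT _))//.
  rewrite /C -RintegralZl//; apply: le_Rintegral => //.
  - exact: integrable_norm.
  - exact: (integrableZl measurableT _ ipsi).
  - by move=> x _; exact/vL/H0_psi.
have vv : `|v| ^+ 2 <= e ^+ 2 * C + e ^+ 2 * `|v|.
  have := vL v mv; have [_ _ ->] := ipV.
  move: Lv; rewrite !ler_norml => /andP[_ h1] /andP[_ h2]; lra.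
have vs : `|v| <= e * (C + 1).
  rewrite leNgt; apply/negP => vgt.
  have v0 := normr_ge0 v.
  (* If [|v|] exceeded [e * (C + 1)], the two terms of [vv] would be at most [e * C * |v|] and
     [e * |v|], whose sum is below [|v| ^+ 2]. *)
  have h1 : e * C * (e * (C + 1)) <= e * C * `|v|.
    by apply: ler_wpM2l; [exact: mulr_ge0 (ltW e0) C0|exact: ltW].
  have h2 : e * e * `|v| <= e * `|v|.
    by rewrite ler_wpM2r// -[leRHS]mulr1 ler_wpM2l// ltW.
  have ec : 0 < e * (C + 1) by rewrite mulr_gt0// ltr_wpDl.
  have h3 : e * (C + 1) * `|v| < `|v| * `|v|.
    by rewrite ltr_pM2r// (lt_trans ec).
  have h4 : 0 <= e * C * (e * C) by rewrite sqr_ge0.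
  rewrite !expr2 in vv; nra.
have := vL w mw.
have := ip_cauchy_schwarz ipV v w.
have h1 : `|v| * `|w| <= e * (C + 1) * `|w| by rewrite ler_wpM2r.
have h2 : e ^+ 2 * `|w| <= e * `|w|.
  by rewrite ler_wpM2r// expr2 -[leRHS]mulr1 ler_wpM2l// ltW.
have h3 : `|L w| <= `|ip v w| + `|ip v w - L w|.
  by rewrite [X in X <= _](_ : _ = `|ip v w - (ip v w - L w)|) ?ler_normB// subKr.
move: eB; rewrite /B; nra.
Qed.

End MeanElementVanishes.

(** * The energy of the centered kernel *)

Lemma measurable_sqrt (R : realType) : measurable_fun [set: R] Num.sqrt.
Proof. by apply: continuous_measurable_fun; exact: sqrt_continuous. Qed.

Section CenteredKernel.
Context (R : realType) (n : nat).
Implicit Types (k : 'rV[R]_n -> 'rV[R]_n -> R) (F : probability 'rV[R]_n R).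

(** With [y = t = phi 0] the right side is [center_at0] term by term: centering the kernel
    translates its feature map by [- phi 0]. *)
Lemma hilbert_productBB (V : completeNormedModType R) (ip : V -> V -> R) :
  hilbert_product ip -> forall x y z t,
  ip (x - y) (z - t) = ip x z + ip y t - ip x t - ip y z.
Proof.
move=> ipV x y z t; have [ipC _ _] := ipV.
rewrite (ipBl ipV) !(ipC _ (z - t)) !(ipBl ipV) !(ipC z) !(ipC t); ring.
Qed.

Lemma valid_kernel_center k : valid_kernel k -> valid_kernel (center_at0 k).
Proof.
move=> [mk [V [ip [phi [ipV kE]]]]]; split; last first.
  exists V, ip, (fun x => phi x - phi 0); split => // x y.
  by rewrite (hilbert_productBB ipV) /center_at0 !kE.
have mk1 : measurable_fun setT (fun z : 'rV[R]_n * 'rV[R]_n => k z.1 0).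
  have mk0 : measurable_fun setT (k^~ 0) := measurable_fun_pair1 (0 : 'rV[R]_n) mk.
  exact: (measurableT_comp mk0 measurable_fst).
have mk2 : measurable_fun setT (fun z : 'rV[R]_n * 'rV[R]_n => k 0 z.2).
  have mk0 : measurable_fun setT (k 0) := measurable_fun_pair2 (0 : 'rV[R]_n) mk.
  exact: (measurableT_comp mk0 measurable_snd).
apply: measurable_funB => //; apply: measurable_funB => //.
exact: measurable_funD.
Qed.

Lemma measurable_diag k : measurable_fun setT
    (fun z : 'rV[R]_n * 'rV[R]_n => k z.1 z.2) ->
  measurable_fun setT (fun x => k x x).
Proof.
move=> mk.
have mid : measurable_fun [set: 'rV[R]_n] id by exact: measurable_id.
exact: (measurableT_comp mk (measurable_fun_pair mid mid)).
Qed.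

Lemma mean_element_dirac0 k x : valid_kernel k ->
  mean_element k (Defs.dirac0 R n) x = k x 0.
Proof.
move=> [mk _]; rewrite /mean_element /Rintegral integral_dirac//.
  by rewrite diracT mul1e.
by apply/measurable_EFinP; exact: (measurable_fun_pair2 x mk).
Qed.

(** [characteristic_kernel] compares only laws with this moment, so the Dirac mass must have it. *)
Lemma sqrt_moment_dirac0 k : valid_kernel k -> sqrt_moment k (Defs.dirac0 R n).
Proof.
move=> [mk _]; rewrite /sqrt_moment integral_dirac//.
  by rewrite diracT mul1e ltry.
apply/measurable_EFinP/(measurableT_comp (@measurable_sqrt R)).
exact: measurable_diag.
Qed.

(** [mean_element_vanishes] is applied to [psi = phi - phi 0] and tested against [phi x]: the
    integral of [k x y - k x 0] over [y] is then 0. *)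
Lemma centered_energy0 k F : valid_kernel k -> sqrt_moment k F ->
  (\int[iid2 F]_z (center_at0 k z.1 z.2)%:E = 0)%E ->
  mean_element k F = mean_element k (Defs.dirac0 R n).
Proof.
move=> hk kF E0; apply/funext => x; rewrite mean_element_dirac0//.
have [mk [V [ip [phi [ipV kE]]]]] := hk.
have [ipC _ ipE] := ipV.
pose psi y := phi y - phi 0.
have psiE y z : ip (psi y) (psi z) = center_at0 k y z.
  by rewrite (hilbert_productBB ipV) /center_at0 !kE.
(* Norms are expressed by the kernel: this makes them measurable and turns [sqrt_moment] into
   integrability of [|phi|]. *)
have normphi y : `|phi y| = Num.sqrt (k y y) by rewrite kE ipE sqrtr_sqr normr_id.
have mbar := (valid_kernel_center hk).1.
have mphi : measurable_fun setT (fun y => `|phi y|).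
  under eq_fun do rewrite normphi.
  apply: (measurableT_comp (@measurable_sqrt R)); exact: measurable_diag.
have mpsi : measurable_fun setT (fun y => `|psi y|).
  rewrite (_ : (fun y => _) = (fun y => Num.sqrt (center_at0 k y y))).
    apply: (measurableT_comp (@measurable_sqrt R)); exact: measurable_diag.
  by apply/funext => y; rewrite -psiE ipE sqrtr_sqr normr_id.
have iphi : F.-integrable setT (fun y => `|phi y|%:E).
  apply/integrableP; split; first exact/measurable_EFinP.
  move: kF; apply: le_lt_trans; rewrite le_eqVlt; apply/orP; left; apply/eqP.
  by apply: eq_integral => y _; rewrite abse_EFin normr_id normphi.
have ipsi : F.-integrable setT (fun y => `|psi y|%:E).
  have := integrableD measurableT iphi
    (finite_measure_integrable_cst F `|phi 0| measurableT).
  apply: le_integrable => //; first exact/measurable_EFinP.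
  move=> y _; rewrite -EFinD !abse_EFin lee_fin normr_id ger0_norm ?addr_ge0//.
  exact: ler_normB.
have kxE y : ip (phi x) (psi y) = k x y - k x 0.
  by rewrite ipC (ipBl ipV) !kE !(ipC (phi x)).
have mkx := measurable_fun_pair2 x mk.
have := mean_element_vanishes ipV (psi := psi) _ ipsi _ (w := phi x).
rewrite (_ : (fun z => ip (psi z.1) (psi z.2)) =
  (fun z => center_at0 k z.1 z.2)); last by apply/funext => z; rewrite psiE.
rewrite (_ : (fun y => ip (phi x) (psi y)) = (fun y => k x y - k x 0)); last first.
  by apply/funext => y; rewrite kxE.
move=> /(_ mbar)/(_ _)/(_ (measurable_funB mkx (measurable_cst _))).
under eq_integral do rewrite psiE.
move=> /(_ E0).
have ikx : F.-integrable setT (fun y => (k x y)%:E).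
  apply: le_integrable (integrableZl measurableT `|phi x| iphi) => //.
    exact/measurable_EFinP.
  move=> y _; rewrite -EFinM !abse_EFin lee_fin [leRHS]ger0_norm ?mulr_ge0//.
  by rewrite kE; exact: ip_cauchy_schwarz.
rewrite RintegralB//; last exact: finite_measure_integrable_cst.
rewrite Rintegral_cst// [fine _](congr1 fine (probability_setT F)) mulr1 => /eqP.
by rewrite subr_eq0 => /eqP.
Qed.

End CenteredKernel.

(** * Borel measurability of vector-valued maps *)

Section BorelRowVectors.
Context (R : realType) (n : nat).

Lemma continuous_measurable_rV (f : 'rV[R]_n -> R) :
  continuous f -> measurable_fun [set: 'rV[R]_n] f.
Proof.
move=> /continuousP cf; apply: (measurability _ (RGenOpens.measurableE R)).
move=> _ [_ [a [b ->] <-]]; rewrite setTI; apply: sub_sigma_algebra.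
exact/cf/interval_open.
Qed.

Lemma measurable_coord (i : 'I_n) :
  measurable_fun [set: 'rV[R]_n] (fun x : 'rV[R]_n => x ord0 i).
Proof. by apply: continuous_measurable_rV; exact: coord_continuous. Qed.

(** Balls with rational centres and radii [1 / (m + 1)] form a countable base. A radius below
    [e / 2] lets two of them fit in [e]. *)
Lemma rV_rat_ball (x : 'rV[R]_n) (e : R) : 0 < e ->
  exists q : 'rV[rat]_n, exists m : nat,
    ball (map_mx ratr q : 'rV[R]_n) m.+1%:R^-1 x /\
    ball (map_mx ratr q : 'rV[R]_n) m.+1%:R^-1 `<=` ball x e.
Proof.
move=> e0; have [m me] : exists m, m.+1%:R^-1 < e / 2 :> R.
  have e20 : 0 < (e / 2)^-1 by rewrite invr_gt0 divr_gt0.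
  exists (Num.truncn (e / 2)^-1); rewrite -[ltRHS]invrK ltf_pV2 ?posrE ?ltr0n//.
  by have /andP[] := truncn_itv (ltW e20).
have m0 : 0 < m.+1%:R^-1 :> R by rewrite invr_gt0.
have qP (i : 'I_n) : exists q : rat, ball (ratr q : R) m.+1%:R^-1 (x ord0 i).
  have := @rat_in_itvoo R (x ord0 i - m.+1%:R^-1) (x ord0 i).
  rewrite ltrBlDr ltrDl m0 => /(_ isT)[q]; rewrite in_itv/= => /andP[q1 q2].
  exists q; rewrite /ball/= ltr_distl.
  move: q1 q2 m0; move: (ratr q) (x ord0 i) (m.+1%:R^-1) => a b c *.
  by apply/andP; split; lra.
pose q : 'rV[rat]_n := \row_i projT1 (cid (qP i)).
have bq : ball (map_mx ratr q : 'rV[R]_n) m.+1%:R^-1 x.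
  split => // i j; rewrite !ord1 !mxE; exact: (projT2 (cid (qP j))).
exists q, m; split => // y qy; rewrite (splitr e).
have le_me := ltW me.
exact: (ball_triangle (ball_sym (le_ball le_me bq)) (le_ball le_me qy)).
Qed.

(** An open set is the countable union of the rational balls inside it, and a ball of the sup norm
    is a finite intersection of coordinate conditions. *)
Lemma measurable_fun_rV d (T : measurableType d) (f : T -> 'rV[R]_n) :
  (forall i, measurable_fun setT (fun t => f t ord0 i)) ->
  measurable_fun setT f.
Proof.
move=> mf; apply: (measurability (@open 'rV[R]_n)) => //.
move=> _ [U oU <-]; rewrite setTI.
pose B (p : 'rV[rat]_n * nat) : set 'rV[R]_n :=
  ball (map_mx ratr p.1 : 'rV[R]_n) p.2.+1%:R^-1.
(* The union runs over the whole countable type; balls not inside [U] contribute [set0]. *)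
rewrite (_ : f @^-1` U = \bigcup_p
    (if `[< B p `<=` U >] then f @^-1` (B p) else set0)).
  apply: countable_bigcupT_measurable => // p.
  case: asboolP => // _.
  rewrite (_ : _ @^-1` _ = \bigcap_(i in [set: 'I_n])
     ((fun t => f t ord0 i) @^-1` ball (ratr (p.1 ord0 i) : R) p.2.+1%:R^-1)).
    apply: fin_bigcap_measurable => // i _.
    by rewrite -[X in measurable X]setTI; apply: mf => //; exact: measurable_ball.
  apply/seteqP; split=> t /=.
    by move=> [_ h] i _; have := h ord0 i; rewrite mxE.
  move=> h; split; first by rewrite invr_gt0.
  by move=> i j; rewrite ord1 mxE; exact: h.
apply/seteqP; split=> t /=; last first.
  by move=> [p _]; case: asboolP => // pU /pU.
move=> Uft; have /nbhs_ballP[e /= e0 eU] := open_nbhs_nbhs (conj oU Uft).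
have [q [m [h1 h2]]] := rV_rat_ball (f t) e0.
have BU : B (q, m) `<=` U by move=> y By; exact/eU/h2.
by exists (q, m) => //; case: asboolP.
Qed.

Lemma measurable_fun_mxE d (T : measurableType d) (f : T -> 'rV[R]_n) i :
  measurable_fun setT f -> measurable_fun setT (fun t => f t ord0 i).
Proof. by move=> mf; exact: (measurableT_comp (measurable_coord i) mf). Qed.

Lemma measurable_rV_set1 (c : 'rV[R]_n) : measurable [set c].
Proof.
rewrite -[[set c]]setCK; apply: measurableC; apply: sub_sigma_algebra => /=.
apply: closed_openC; apply/accessible_closed_set1/hausdorff_accessible.
exact: norm_hausdorff.
Qed.

End BorelRowVectors.

(** * Radial kernels and their maximum *)

Section RadialKernel.
Context (R : realType) (n : nat).

Definition dotr (x w : 'rV[R]_n) : R := (x *m w^T) ord0 ord0.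

Lemma continuous_dotr (x : 'rV[R]_n) : continuous (dotr x).
Proof.
rewrite (_ : dotr x = fun w => \sum_j x ord0 j * w ord0 j).
  elim: (index_enum _) => [|j s ihs] w.
    rewrite (_ : (fun _ => _) = cst 0); first exact: cst_continuous.
    by apply/funext => z; rewrite big_nil.
  rewrite (_ : (fun _ => _) = (fun w : 'rV[R]_n => x ord0 j * w ord0 j) \+
      (fun w : 'rV[R]_n => \sum_(i <- s) x ord0 i * w ord0 i)); last first.
    by apply/funext => z; rewrite big_cons.
  have coord_w : {for w, continuous (fun w : 'rV[R]_n => w ord0 j)}.
    exact: coord_continuous.
  exact: (continuousD (continuous_comp coord_w (@mulrl_continuous R _ _)) (ihs w)).
by apply/funext => w; rewrite /dotr mxE; apply: eq_bigr => j _; rewrite mxE.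
Qed.

Lemma continuous_cos_dotr (x : 'rV[R]_n) : continuous (fun w => cos (dotr x w)).
Proof.
by move=> w; apply: continuous_comp; [exact: continuous_dotr|exact: continuous_cos].
Qed.

Variables (k : 'rV[R]_n -> 'rV[R]_n -> R)
  (La : {finite_measure set 'rV[R]_n -> \bar R}).
Hypothesis La_full : measure_support La = setT.
Hypothesis kE : forall x y, (k x y)%:C%C =
  complex_integral La (fun w => expi (- ((x - y) *m w^T) ord0 ord0)).

(** The kernel is the real part of the spectral integral, and cosine being even removes the sign of
    the phase. *)
Lemma radial_kernelE x y : k x y = (\int[La]_w cos (dotr (x - y) w))%R.
Proof.
have := congr1 (@complex.Re R) (kE x y); rewrite /complex_integral/= => ->.
by apply: eq_Rintegral => w _; rewrite cosN.
Qed.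

Lemma integrable_cos_dotr x : La.-integrable setT (fun w => (cos (dotr x w))%:E).
Proof.
apply: measurable_bounded_integrable => //.
- by rewrite ltey_eq fin_num_measure.
- by apply: continuous_measurable_rV; exact: continuous_cos_dotr.
- exists 1; split => // M M1 w _ /=; rewrite (le_trans _ (ltW M1))//.
  by rewrite ler_norml cos_geN1 cos_le1.
Qed.

Lemma radial_kernel_diag x : k x x = k 0 0.
Proof. by rewrite !radial_kernelE !subrr. Qed.

Lemma radial_kernel00 : k 0 0 = fine (La setT).
Proof.
rewrite radial_kernelE subrr -[RHS]mul1r -Rintegral_cst//.
by apply: eq_Rintegral => w _; rewrite /dotr mul0mx mxE cos0.
Qed.

(** The integrand is nonnegative, so both the maximality of [k 0 0] and its equality case are read
    off this formula. *)
Lemma radial_kernelB x y :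
  k 0 0 - k x y = (\int[La]_w (1 - cos (dotr (x - y) w)))%R.
Proof.
rewrite radial_kernel00 -[X in X - _]mul1r -Rintegral_cst// radial_kernelE.
rewrite -RintegralB//; [exact: finite_measure_integrable_cst|].
exact: integrable_cos_dotr.
Qed.

Lemma radial_kernel_le x y : k x y <= k 0 0.
Proof.
rewrite -subr_ge0 radial_kernelB; apply: Rintegral_ge0 => w _.
by rewrite subr_ge0 cos_le1.
Qed.

Lemma radial_kernel_geN x y : - k 0 0 <= k x y.
Proof.
rewrite radial_kernel00 -[X in - X]mul1r -mulNr -Rintegral_cst// radial_kernelE.
apply: le_Rintegral => //; [exact: finite_measure_integrable_cst| |].
  exact: integrable_cos_dotr.
by move=> w _; exact: cos_geN1.
Qed.

(** Together with measurability, this bound gives integrability against every finite measure, in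
    particular both Jordan parts of [nuF F]. *)
Lemma radial_kernel_norm x y : `|k x y| <= k 0 0.
Proof. by rewrite ler_norml radial_kernel_le radial_kernel_geN. Qed.

(* If [x != y], pick [w] with [(x - y) . w = pi]: near [w] the integrand of
   [radial_kernelB] is positive, and [La] charges that neighbourhood. *)
Lemma radial_kernel_max x y : k x y = k 0 0 -> x = y.
Proof.
move=> kxy; apply/eqP; rewrite -subr_eq0; set v := x - y; apply/negP => /negP v0.
have dvv : dotr v v != 0.
  rewrite /dotr mxE; under eq_bigr do rewrite [_^T _ _]mxE -expr2.
  rewrite psumr_eq0; last by move=> j _; exact: sqr_ge0.
  apply: contra v0 => /allP h; apply/eqP/rowP => j; rewrite [RHS]mxE.
  by have := h j (mem_index_enum _); rewrite /= sqrf_eq0 => /eqP.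
pose w := (pi / dotr v v) *: v.
have dvw : dotr v w = pi.
  by rewrite /w /dotr linearZ/= -scalemxAr [LHS]mxE -/(dotr v v) divfK.
pose h w := 1 - cos (dotr v w).
have ch : continuous h.
  have c1 : continuous (fun _ : 'rV[R]_n => 1 : R) by exact: cst_continuous.
  by move=> z; exact: (continuousB (c1 z) (@continuous_cos_dotr v z)).
(* [h w = 1 - cos pi = 2], so [U] is an open neighbourhood of [w] on which [h] does not vanish. *)
pose U := h @^-1` `]1, +oo[%classic.
have oU : open U by apply: open_comp => // z _; exact: ch.
have Uw : U w by rewrite /U/= /h dvw cospi opprK in_itv/= andbT ltrDl.
have /(_ U oU Uw) : measure_support La w by rewrite La_full.
have mh : measurable_fun setT h by exact: continuous_measurable_rV.
have h0 z : 0 <= h z by rewrite subr_ge0 cos_le1.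
have mU : measurable U.
  by rewrite -[U]setTI; apply: mh => //; exact: measurable_itv.
suff -> : La U = 0%E by rewrite ltxx.
(* The integral is [k 0 0 - k x y = 0], so [h] vanishes almost everywhere and [U] is a null set. *)
have : (\int[La]_z `|(h z)%:E| = 0)%E.
  under eq_integral do rewrite gee0_abs ?lee_fin//.
  have ih : La.-integrable setT (fun z => (h z)%:E).
    exact: (integrableB measurableT (finite_measure_integrable_cst La 1 measurableT)
       (integrable_cos_dotr v)).
  rewrite -[LHS]fineK; last exact: integrable_fin_num.
  congr (_%:E); have := radial_kernelB x y; rewrite kxy subrr => /esym.
  exact.
have mhE : measurable_fun setT (fun z => (h z)%:E) by exact/measurable_EFinP.
move=> /(ae_eq_integral_abs _ measurableT mhE) ae0.
apply: measure_negligible => //; apply: negligibleS ae0 => z Uz /= /(_ I) [hz].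
by move: Uz; rewrite /U/= hz in_itv/= andbT ltr10.
Qed.

End RadialKernel.

(** * Partial expectations under independence *)

Lemma integral_distributionE (dO d1 : measure_display)
    (Omega : measurableType dO) (T1 : measurableType d1) (R : realType)
    (P : probability Omega R) (X : {RV P >-> T1}) (f : T1 -> \bar R) :
  measurable_fun setT f ->
  (\int[distribution P X]_x f x = \int[P]_w (f \o X) w)%E.
Proof.
(* The change of variables for nonnegative functions is used on the positive and negative parts. *)
move=> mf; rewrite integralE [RHS]integralE.
have mp := measurable_funepos mf.
have mn := measurable_funeneg mf.
rewrite !ge0_integral_distribution//.
by rewrite -funepos_comp -funeneg_comp.
Qed.

Section PartialExpectation.
Context (dO : measure_display) (Omega : measurableType dO) (R : realType)
  (P : probability Omega R).
Context (d1 d2 : measure_display) (T1 : measurableType d1)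
  (T2 : measurableType d2).

(** Independence says that the joint law agrees with the product law on rectangles, hence
    everywhere. *)
Lemma integral_independent (X : {RV P >-> T1}) (Y : {RV P >-> T2})
    (f : T1 * T2 -> \bar R) :
  independent_rv P X Y -> measurable_fun setT f ->
  (\int[distribution P X \x distribution P Y]_z f z
   = \int[P]_w f (X w, Y w))%E.
Proof.
move=> XY mf.
have mXY : measurable_fun setT (fun w => (X w, Y w)).
  exact: measurable_fun_pair.
pose XYm : {mfun Omega >-> (T1 * T2)%type} :=
  HB.pack (fun w => (X w, Y w)) (isMeasurableFun.Build _ _ _ _ _ mXY).
rewrite -(integral_distributionE XYm mf); apply: eq_measure_integral => A mA _.
exact: product_measure_unique.
Qed.

Lemma partial_expectation (X : {RV P >-> T1}) (Y : {RV P >-> T2})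
    (f : T1 * T2 -> R) (h := fun x => fine 'E_P[fun w => f (x, Y w)]) :
  independent_rv P X Y -> measurable_fun setT f ->
  P.-integrable setT (fun w => (f (X w, Y w))%:E) ->
  [/\ measurable_fun setT h, P.-integrable setT (fun w => (h (X w))%:E)
    & (\int[P]_w (h (X w))%:E = \int[P]_w (f (X w, Y w))%:E)%E].
Proof.
move=> XY mf fXY.
have mfE : measurable_fun setT (fun z => (f z)%:E) by exact/measurable_EFinP.
have fprod : (distribution P X \x distribution P Y)%E.-integrable setT
    (fun z => (f z)%:E).
  apply/integrableP; split => //.
  rewrite (integral_independent XY); last exact: measurableT_comp.
  by have /integrableP[] := fXY.
pose G := fubini_F (distribution P Y) (fun z => (f z)%:E).
have hG x : h x = fine (G x).
  rewrite /h /G /fubini_F unlock integral_distributionE//.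
  exact: (measurable_fun_pair2 x mfE).
have iG : (distribution P X).-integrable setT G by exact: integrable_fubini_F.
have mG : measurable_fun setT G by exact: measurable_int iG.
have mh : measurable_fun setT h.
  rewrite (_ : h = fine \o G); last by apply/funext => y; rewrite hG.
  exact: measurableT_comp.
(* [G] is integrable, hence finite almost everywhere, so the default value of [fine] is met only on
   a null set. *)
have hEG : ae_eq (distribution P X) setT (fun y => (h y)%:E) G.
  have := integrable_ae measurableT iG; apply: filterS => y /= /(_ I) Gy _.
  by rewrite hG fineK.
have mhE : measurable_fun setT (fun y => (h y)%:E) by exact/measurable_EFinP.
split => //; last first.
  rewrite -(integral_independent XY mfE) -integral12_prod_meas1//.
  rewrite -[LHS](integral_distributionE X mhE).
  exact: ae_eq_integral.
apply/integrableP; split; first exact: (measurableT_comp mhE).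
rewrite -[X in (X < _)%E](integral_distributionE X (f := fun y => `|(h y)%:E|%E)); last first.
  exact: measurableT_comp.
rewrite (ae_eq_integral (fun y => `|G y|%E))//; first by have /integrableP[] := iG.
- exact: measurableT_comp.
- exact: measurableT_comp.
- exact: ae_eq_abse.
Qed.

End PartialExpectation.

(** * Point masses with mean zero *)

Section CenteredLaw.
Context (dO : measure_display) (Omega : measurableType dO) (R : realType)
  (P : probability Omega R) (n : nat).

(** [V = c] almost surely, so the mean 0 of each coordinate is that coordinate of [c]. *)
Lemma centered_point_mass (V : Omega -> 'rV[R]_n) (F : probability 'rV[R]_n R)
    (c : 'rV[R]_n) :
  measurable_fun setT V ->
  (forall i, (\int[P]_w (V w ord0 i)%:E = 0)%E) ->
  Defs.eq_measure (pushforward P V) F -> F (~` [set c]) = 0%E -> c = 0.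
Proof.
move=> mV V0 VF Fc; apply/rowP => i; rewrite mxE.
have mc : measurable (~` [set c]) by apply: measurableC; exact: measurable_rV_set1.
have Vc : P (V @^-1` (~` [set c])) = 0%E by rewrite -Fc -(VF _ mc).
have : (\int[P]_w (V w ord0 i)%:E = \int[P]_w (c ord0 i)%:E)%E.
  apply: ae_eq_integral => //.
    by apply/measurable_EFinP; exact: measurable_fun_mxE.
  exists (V @^-1` (~` [set c])); split => //.
    by rewrite -[X in measurable X]setTI; exact: mV.
  by move=> w /= h Vw; apply: h => _; rewrite Vw.
by rewrite V0 integral_cst// [X in (_ * X)%E](probability_setT P) mule1 => -[].
Qed.

End CenteredLaw.

(** * The ANOVA functionals have mean zero *)

Section AnovaCentered.
Context (dO : measure_display) (Omega : measurableType dO) (R : realType)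
  (P : probability Omega R) (d n : nat).
Variables (f : {mfun 'rV[R]_d >-> 'rV[R]_n}) (X : {RV P >-> 'rV[R]_d})
  (u : {set 'I_d})
  (r : {mfun ('rV[R]_#|u| * 'rV[R]_(d - #|u|))%type >-> 'rV[R]_#|~: u|})
  (Z : {RV P >-> 'rV[R]_(d - #|u|)}).

Lemma measurable_subvec (A : {set 'I_d}) :
  measurable_fun [set: 'rV[R]_d] (@subvec R d A).
Proof.
apply: measurable_fun_rV => i.
by under eq_fun do rewrite mxE; exact: measurable_coord.
Qed.

Lemma measurable_merge d' (T : measurableType d') (x : T -> 'rV[R]_#|u|)
    (y : T -> 'rV[R]_#|~: u|) :
  measurable_fun setT x -> measurable_fun setT y ->
  measurable_fun setT (fun t => Defs.merge (x t) (y t)).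
Proof.
have msum m (z : T -> 'rV[R]_m) (Q : pred 'I_m) : measurable_fun setT z ->
    measurable_fun setT (fun t => \sum_(i | Q i) z t ord0 i).
  move=> mz; rewrite (_ : (fun t => _) =
      fun t => \sum_i (if Q i then z t ord0 i else 0)); last first.
    by apply/funext => t; rewrite big_mkcond.
  by apply: measurable_sum => i; case: (Q i) => //; exact: measurable_fun_mxE.
move=> mx my; apply: measurable_fun_rV => j.
under eq_fun do rewrite mxE.
by apply: measurable_funD; exact: msum.
Qed.

Lemma measurable_outg i :
  measurable_fun setT (fun t : 'rV[R]_#|u| * 'rV[R]_(d - #|u|) =>
    outg f r t.1 t.2 ord0 i).
Proof.
apply: measurable_fun_mxE; apply: measurableT_comp => //.
apply: measurable_merge; first exact: measurable_fst.
by under eq_fun do rewrite -surjective_pairing; exact: measurable_funP.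
Qed.

Lemma measurable_Xu : measurable_fun setT (Xu X u).
Proof. exact: (measurableT_comp (@measurable_subvec u)). Qed.

Hypothesis dm : dependency_model f X r Z.
Hypothesis gexp : expectation_exists f X r Z.

Let Xum : {RV P >-> 'rV[R]_#|u|} :=
  HB.pack (Xu X u) (isMeasurableFun.Build _ _ _ _ _ measurable_Xu).

Let XZ : independent_rv P Xum Z. Proof. exact: dm_indep dm. Qed.

(** In the total functional the inner expectation is over [Xu], so Fubini is applied with the roles
    exchanged. *)
Let ZX : independent_rv P Z Xum.
Proof. by move=> A B mA mB; rewrite setIC XZ// muleC. Qed.

Lemma AF_total_point_mass (F : probability 'rV[R]_n R) c :
  Defs.eq_measure (pushforward P (fun w => AF_total f X r (Xu X u w) (Z w))) F ->
  F (~` [set c]) = 0%E -> c = 0.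
Proof.
have mswap i : measurable_fun setT (fun t : 'rV[R]_(d - #|u|) * 'rV[R]_#|u| =>
    outg f r t.2 t.1 ord0 i).
  have mt : measurable_fun setT
    (fun t : 'rV[R]_(d - #|u|) * 'rV[R]_#|u| => (t.2, t.1)).
    exact: measurable_fun_pair.
  exact: (measurableT_comp (measurable_outg i) mt).
have pe i := partial_expectation ZX (mswap i) (gexp i).
have mgXZ i : measurable_fun setT (fun w => outg f r (Xu X u w) (Z w) ord0 i).
  by apply/measurable_EFinP; exact: measurable_int (gexp i).
apply: centered_point_mass.
  apply: measurable_fun_rV => i; under eq_fun do rewrite mxE.
  apply: measurable_funB; first exact: mgXZ.
  by have [mh _ _] := pe i; exact: (measurableT_comp mh).
move=> i; have [_ ih hE] := pe i.
under eq_integral do rewrite mxE EFinB.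
rewrite (integralB measurableT (gexp i) ih) hE subee//.
exact: (integrable_fin_num measurableT (gexp i)).
Qed.

(** By Fubini the mean of the inner expectation over [Z] is the full expectation, which is the
    constant subtracted. *)
Lemma AF_first_order_point_mass (F : probability 'rV[R]_n R) c :
  Defs.eq_measure (pushforward P (fun w => AF_first_order f X r Z (Xu X u w))) F ->
  F (~` [set c]) = 0%E -> c = 0.
Proof.
have pe i := partial_expectation XZ (measurable_outg i) (gexp i).
apply: centered_point_mass.
  apply: measurable_fun_rV => i; under eq_fun do rewrite mxE.
  apply: measurable_funB => //.
  by have [mh _ _] := pe i; exact: (measurableT_comp mh measurable_Xu).
move=> i; have [_ ih hE] := pe i.
under eq_integral do rewrite mxE EFinB.
rewrite (integralB measurableT ih (finite_measure_integrable_cst P _ measurableT)).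
have cstE m : (\int[P]_w m%:E = m%:E)%E.
  by rewrite integral_cst// [X in (_ * X)%E](probability_setT P) mule1.
rewrite hE [X in (_ - X)%E]cstE expectation.unlock fineK.
  by rewrite subee//; exact: (integrable_fin_num measurableT (gexp i)).
exact: (integrable_fin_num measurableT (gexp i)).
Qed.

End AnovaCentered.

(** * Product measures, signed integrals and point masses *)

Section PointMass.
Context (R : realType).

(** The product measure of [A] is the integral of the measures of its sections, so almost every
    section is null; as [F] has mass 1, at least one is. *)
Lemma product_null_section d (T : measurableType d) (F : probability T R)
    (A : set (T * T)) :
  measurable A -> (F \x F)%E A = 0%E -> exists c, F (xsection A c) = 0%E.
Proof.
move=> mA FA0; apply/not_existsP => Fc.
have mF : measurable_fun setT (F \o xsection A).
  exact: measurable_fun_xsection.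
have : (\int[F]_x `|(F \o xsection A) x| = 0)%E.
  by rewrite -[RHS]FA0; apply: eq_integral => x _; rewrite gee0_abs.
move=> /(ae_eq_integral_abs _ measurableT mF) ae0.
have : F setT = 0%E.
  apply: measure_negligible => //; apply: negligibleS ae0 => x _ /= /(_ I).
  exact: Fc.
by rewrite probability_setT => /eqP; rewrite onee_eq0.
Qed.

Variable n : nat.
Implicit Types F : probability 'rV[R]_n R.

Lemma point_mass0 F : F (~` [set 0]) = 0%E -> Defs.eq_measure F (Defs.dirac0 R n).
Proof.
move=> F0 A mA.
have m0 : measurable (~` [set (0 : 'rV[R]_n)]).
  by apply: measurableC; exact: measurable_rV_set1.
have null (B : set 'rV[R]_n) : measurable B -> ~ B 0 -> F B = 0%E.
  move=> mB B0; apply: (subset_measure0 mB m0) => // x Bx /= x0.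
  by apply: B0; rewrite -x0.
rewrite [RHS]diracE; case: (pselect (A 0)) => A0.
  rewrite mem_set//= -[A]setCK probability_setC; last exact: measurableC.
  by rewrite null ?sube0//; exact: measurableC.
by rewrite memNset//= null.
Qed.

Lemma nuF_point_mass0 F : Defs.eq_measure F (Defs.dirac0 R n) ->
  Defs.eq_measure (nuF F) (fun=> 0%E).
Proof.
move=> FH A mA.
have iidE : iid2 F A = iid2 (Defs.dirac0 R n) A.
  (* [F] is replaced first on the measurable sections, then as the outer measure. *)
  transitivity (\int[F]_x Defs.dirac0 R n (xsection A x))%E.
    by apply: eq_integral => x _ /=; apply: FH; exact: measurable_xsection.
  by apply: eq_measure_integral => B mB _; exact: FH.
transitivity (iid2 F A - iid2 (Defs.dirac0 R n) A)%E => //.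
by rewrite iidE subee// fin_num_measure.
Qed.

Lemma integrable_bounded_kernel (k : 'rV[R]_n -> 'rV[R]_n -> R) (M : R)
    (m : {finite_measure set ('rV[R]_n * 'rV[R]_n)%type -> \bar R}) :
  measurable_fun setT (fun z : 'rV[R]_n * 'rV[R]_n => k z.1 z.2) ->
  (forall x y, `|k x y| <= M) ->
  m.-integrable setT (fun z => (k z.1 z.2)%:E).
Proof.
move=> mk kM; apply: measurable_bounded_integrable => //.
  by rewrite ltey_eq fin_num_measure.
by exists M; split; [exact: num_real|]=> N MN z _ /=; rewrite (le_trans _ (ltW MN)).
Qed.

Lemma integral_iid2_dirac0 (k : 'rV[R]_n -> 'rV[R]_n -> R) :
  measurable_fun setT (fun z : 'rV[R]_n * 'rV[R]_n => k z.1 z.2) ->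
  (iid2 (Defs.dirac0 R n)).-integrable setT (fun z => (k z.1 z.2)%:E) ->
  (\int[iid2 (Defs.dirac0 R n)]_z (k z.1 z.2)%:E = (k 0 0)%:E)%E.
Proof.
move=> mk ik; rewrite -(integral12_prod_meas1 ik) /fubini_F/=.
have mkE : measurable_fun setT
    (fun z : 'rV[R]_n * 'rV[R]_n => (k z.1 z.2)%:E) by exact/measurable_EFinP.
rewrite integral_dirac//; last first.
  exact: measurable_int (integrable_fubini_F ik).
rewrite diracT mul1e integral_dirac//; first by rewrite diracT mul1e.
exact: (measurable_fun_pair2 _ mkE).
Qed.

Let fin_sub_eq_add (a b x y : \bar R) : a \is a fin_num -> b \is a fin_num ->
  x \is a fin_num -> y \is a fin_num ->
  (x - y = a - b -> b + x = a + y)%E.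
Proof.
move: a b x y => [a||]// [b||]// [x||]// [y||]// _ _ _ _.
by rewrite -!EFinB -!EFinD => -[h]; congr (_%:E); lra.
Qed.

(** The Jordan identity is rearranged into an equality of sums of positive measures,
    [mn + F x F = mp + H x H]. Integrals add over such sums, and the finite integrals against [mp]
    and [mn] are equal and cancel. *)
Lemma charge_integral_nuF F (k : 'rV[R]_n -> 'rV[R]_n -> R) (M : R) :
  measurable_fun setT (fun z : 'rV[R]_n * 'rV[R]_n => k z.1 z.2) ->
  (forall x y, `|k x y| <= M) ->
  charge_integral (nuF F) (fun z => (k z.1 z.2)%:E) = 0%E ->
  (\int[iid2 F]_z (k z.1 z.2)%:E = (k 0 0)%:E)%E.
Proof.
move=> mk kM.
have ik (m : {finite_measure set ('rV[R]_n * 'rV[R]_n)%type -> \bar R}) :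
    m.-integrable setT (fun z => (k z.1 z.2)%:E).
  exact: integrable_bounded_kernel kM.
rewrite /charge_integral.
set mp := jordan_pos _; set mn := jordan_neg _ => I0.
rewrite -(integral_iid2_dirac0 mk (ik _)).
have fp := integrable_fin_num measurableT (ik mp).
have fn := integrable_fin_num measurableT (ik mn).
have Ipn : (\int[mp]_z (k z.1 z.2)%:E = \int[mn]_z (k z.1 z.2)%:E)%E.
  move: I0; rewrite -(fineK fp) -(fineK fn) -EFinB => -[/eqP].
  by rewrite subr_eq0 => /eqP ->.
have : (\int[measure_add mn (iid2 F)]_z (k z.1 z.2)%:E =
    \int[measure_add mp (iid2 (Defs.dirac0 R n))]_z (k z.1 z.2)%:E)%E.
  apply: eq_measure_integral => A mA _.
  apply: etrans (measure_addE _ _ _) _.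
  apply: etrans (esym (measure_addE _ _ _)).
  have : (iid2 F A - iid2 (Defs.dirac0 R n) A = mp A - mn A)%E.
    rewrite -[LHS]/(nuF F A) (jordan_decomp (hahn_posneg (nuF F)) mA).
    by rewrite /cadd/= cscaleN1.
  by apply: fin_sub_eq_add; exact: fin_num_measure.
rewrite !integral_measure_add//; [|exact: ik..].
have ff := integrable_fin_num measurableT (ik (iid2 F)).
have fh := integrable_fin_num measurableT (ik (iid2 (Defs.dirac0 R n))).
rewrite Ipn -(fineK fn) -(fineK ff) -(fineK fh) -!EFinD => -[/addrI h].
by rewrite h.
Qed.

End PointMass.

(** * Radial kernels detect point masses; conclusion *)

Lemma radial_point_mass (R : realType) (n : nat)
    (k : 'rV[R]_n -> 'rV[R]_n -> R) (F : probability 'rV[R]_n R) :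
  valid_kernel k -> radial_characteristic_kernel k ->
  charge_integral (nuF F) (fun z => (k z.1 z.2)%:E) = 0%E ->
  exists c, F (~` [set c]) = 0%E.
Proof.
move=> [mk _] [La [La_full kE]] I0.
have kM := radial_kernel_norm kE.
have Ik := charge_integral_nuF mk kM I0.
pose h (z : 'rV[R]_n * 'rV[R]_n) := k 0 0 - k z.1 z.2.
have h0 z : 0 <= h z by rewrite subr_ge0; exact: radial_kernel_le.
have mh : measurable_fun setT h by exact: measurable_funB.
have mhE : measurable_fun setT (fun z => (h z)%:E) by exact/measurable_EFinP.
have ik : (iid2 F).-integrable setT (fun z => (k z.1 z.2)%:E).
  exact: integrable_bounded_kernel kM.
(* Both [k 0 0] and [k] integrate to [k 0 0] under [F x F]. *)
have : (\int[iid2 F]_z `|(h z)%:E| = 0)%E.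
  under eq_integral do rewrite gee0_abs ?lee_fin//.
  have c00 := finite_measure_integrable_cst (iid2 F) (k 0 0) measurableT.
  rewrite (integralB measurableT c00 ik) Ik.
  rewrite [X in (X - _)%E](_ : _ = (k 0 0)%:E) ?subee//.
  transitivity ((k 0 0)%:E * iid2 F setT)%E.
    exact: (integral_cst (iid2 F) measurableT (k 0 0)%:E).
  by rewrite probability_setT mule1.
move=> /(ae_eq_integral_abs _ measurableT mhE) ae0.
have mA : measurable (h @^-1` [set~ 0]).
  rewrite -[X in measurable X]setTI.
  by apply: mh => //; exact: measurableC.
have FA0 : iid2 F (h @^-1` [set~ 0]) = 0%E.
  apply: measure_negligible => //.
  by apply: negligibleS ae0 => z /= hz /(_ I) [].
have [c Fc] := product_null_section mA FA0.
(* Since [h] vanishes exactly on the diagonal, the section at [c] of its nonzero set is the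
   complement of [c]. *)
exists c; rewrite -[RHS]Fc; congr (F _); apply/seteqP; split => y /=.
  move=> yc; rewrite /xsection/= inE/= /h => /eqP.
  rewrite subr_eq0 eq_sym => /eqP /(radial_kernel_max La_full kE) cy.
  exact: yc (esym cy).
rewrite /xsection/= inE/= => hy yc; apply: hy.
by rewrite /h yc/= (radial_kernel_diag kE) subrr.
Qed.

Theorem lemma3 (R : realType) (d n : nat)
  (dO : measure_display) (Omega : measurableType dO) (P : probability Omega R)
  (f : {mfun 'rV[R]_d >-> 'rV[R]_n})
  (X : {RV P >-> 'rV[R]_d})
  (r : forall u : {set 'I_d},
     {mfun ('rV[R]_#|u| * 'rV[R]_(d - #|u|))%type >-> 'rV[R]_#|~: u|})
  (Z : forall u : {set 'I_d}, {RV P >-> 'rV[R]_(d - #|u|)})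
  (hmodel : forall u : {set 'I_d}, u != finset.set0 ->
     dependency_model f X (r u) (Z u))
  (hexp : forall u : {set 'I_d}, u != finset.set0 ->
     expectation_exists f X (r u) (Z u))
  (k : 'rV[R]_n -> 'rV[R]_n -> R)
  (hk : valid_kernel k)
  (hmoment : forall F, AF_laws f X r Z F -> sqrt_moment k F) :
  (characteristic_kernel k -> KE (AF_laws f X r Z) (center_at0 k)) /\
  (radial_characteristic_kernel k -> KE (AF_laws f X r Z) k).
Proof.
split=> [char_k|rad_k].
  split; first exact: valid_kernel_center.
  left; split=> [x|F FF E0]; first by rewrite /center_at0; ring.
  have kF := hmoment F FF.
  have kH := sqrt_moment_dirac0 hk.
  by have [+ _] := char_k F (Defs.dirac0 R n) kF kH; apply; exact: centered_energy0.
split=> //; right=> F FF I0.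
have [c Fc] := radial_point_mass hk rad_k I0.
(* The kernel depends only on [x - y] and cannot locate the point mass; the zero mean of the ANOVA
   functionals does. *)
apply/nuF_point_mass0/point_mass0; suff <- : c = 0 by [].
have [u u0 [FE|FE]] := FF.
  exact: (AF_total_point_mass (hmodel u u0) (hexp u u0) FE Fc).
exact: (AF_first_order_point_mass (hmodel u u0) (hexp u u0) FE Fc).
Qed.
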